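(* Let $F$ be a field which either has characteristic $0$, or is algebraically closed of characteristic greater than $5$. Then supersolvability is 2-recognizeable for Leibniz algebras over $F$; that is, if $L$ is a finite-dimensional Leibniz algebra over $F$ such that for all $x,y\in L$ the subalgebra of $L$ generated by $x$ and $y$ is supersolvable, then $L$ is supersolvable.
   Context: A (left) Leibniz algebra over a field $F$ is an $F$-vector space $L$ with a bilinear product $(x,y)\mapsto xy$ such that every left multiplication $L_x: y\mapsto xy$ is a derivation, i.e. $x(yz)=(xy)z+y(xz)$ for all $x,y,z\in L$. All algebras are finite-dimensional. Ideals are two-sided. $L$ is supersolvable if there is a chain $0=I_0\subset I_1\subset\dots\subset I_n=L$ of ideals of $L$ with $\dim I_s=s$ for each $s$. A property of algebras is called $n$-recognizeable if, whenever all the $n$-generated subalgebras (subalgebras generated by $n$ elements) of an algebra $L$ have the property, then $L$ also has the property. *)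

(* Defs.v *)
From HB Require Import structures.
From mathcomp Require Import all_boot all_order all_algebra.

Set Implicit Arguments.
Unset Strict Implicit.
Unset Printing Implicit Defensive.

Import GRing.Theory.
Local Open Scope ring_scope.

(* Finite-dimensional left Leibniz algebras; finite dimension comes from
   vectType. *)
HB.mixin Record Vector_isLeibniz (F : fieldType) L of Vector F L := {
  lbz : L -> L -> L;
  lbz_linearl : forall y, linear (fun x => lbz x y);
  lbz_linearr : forall x, linear (lbz x);
  lbz_leibniz :
    forall x y z, lbz x (lbz y z) = lbz (lbz x y) z + lbz y (lbz x z)
}.

#[short(type="leibnizType")]
HB.structure Definition Leibniz (F : fieldType) :=
  {L of Vector_isLeibniz F L & Vector F L}.

Section Subalgebras.

Variables (F : fieldType) (L : leibnizType F).

Definition is_subalg (A : {vspace L}) : Prop :=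
  forall x y, x \in A -> y \in A -> lbz x y \in A.

Record subalgebra := Subalgebra {
  subalg_val :> {vspace L};
  subalg_closed : is_subalg subalg_val
}.

Definition is_ideal (I : {vspace L}) : Prop :=
  forall x a, a \in I -> lbz x a \in I /\ lbz a x \in I.

Definition supersolvable : Prop :=
  exists n (I : nat -> {vspace L}),
    [/\ I 0 = 0%VS,
        I n = fullv,
        (forall s, (s < n)%N -> (I s <= I s.+1)%VS)
      & forall s, (s <= n)%N -> is_ideal (I s) /\ \dim (I s) = s].

Definition generates (X : seq L) (A : subalgebra) : Prop :=
  {subset X <= subalg_val A} /\
  forall B : subalgebra, {subset X <= subalg_val B} -> (A <= B)%VS.

End Subalgebras.

Section SubalgebraLeibniz.

Variables (F : fieldType) (L : leibnizType F) (A : subalgebra L).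

Definition subalg_lbz (u v : subvs_of A) : subvs_of A :=
  Subvs (subalg_closed (valP u) (valP v)).

Fact subalg_lbz_linearl v : linear (fun u => subalg_lbz u v).
Proof. by move=> a x y; apply: val_inj; rewrite /= lbz_linearl. Qed.

Fact subalg_lbz_linearr u : linear (subalg_lbz u).
Proof. by move=> a x y; apply: val_inj; rewrite /= lbz_linearr. Qed.

Fact subalg_lbz_leibniz u v w :
  subalg_lbz u (subalg_lbz v w) =
  subalg_lbz (subalg_lbz u v) w + subalg_lbz v (subalg_lbz u w).
Proof. by apply: val_inj; rewrite /= lbz_leibniz. Qed.

HB.instance Definition _ := Vector_isLeibniz.Build F (subvs_of A)
  subalg_lbz_linearl subalg_lbz_linearr subalg_lbz_leibniz.

End SubalgebraLeibniz.

Definition recognizeable (F : fieldType) (n : nat)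
    (P : leibnizType F -> Prop) : Prop :=
  forall L : leibnizType F,
    (forall (X : n.-tuple L) (A : subalgebra L),
       generates X A -> P (subvs_of A)) ->
    P L.

(* Every finite family does generate a subalgebra, so quantifying over A with
   generates X A is never vacuous. *)
Section Existence.

Variables (F : fieldType) (L : leibnizType F).

Let step (U : {vspace L}) : {vspace L} :=
  (U + <<[seq lbz u v | u <- vbasis U, v <- vbasis U]>>)%VS.

Let step_lbz (U : {vspace L}) x y : x \in U -> y \in U -> lbz x y \in step U.
Proof.
move=> xU yU; apply: (subvP (addvSr _ _)).
set W := span _.
have suml (I : Type) (r : seq I) (c : I -> F) (e : I -> L) z :
    (forall i, lbz (e i) z \in W) -> lbz (\sum_(i <- r) c i *: e i) z \in W.
  move=> eW; elim: r => [|i r IHr].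
    rewrite big_nil; have := lbz_linearl z (-1) 0 0.
    by rewrite scaler0 addr0 scaleN1r addNr => ->; apply: mem0v.
  by rewrite big_cons lbz_linearl memvD ?memvZ.
have sumr (I : Type) (r : seq I) (c : I -> F) (e : I -> L) z :
    (forall i, lbz z (e i) \in W) -> lbz z (\sum_(i <- r) c i *: e i) \in W.
  move=> eW; elim: r => [|i r IHr].
    rewrite big_nil; have := lbz_linearr z (-1) 0 0.
    by rewrite scaler0 addr0 scaleN1r addNr => ->; apply: mem0v.
  by rewrite big_cons lbz_linearr memvD ?memvZ.
rewrite (coord_vbasis xU) (coord_vbasis yU).
apply: suml => i; apply: sumr => j; apply: memv_span.
by apply: allpairs_f; apply: mem_nth; rewrite size_tuple.
Qed.

Let step_min (U : {vspace L}) (B : subalgebra L) :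
  (U <= B)%VS -> (step U <= B)%VS.
Proof.
move=> UB; rewrite subv_add UB /=.
apply/span_subvP=> w /allpairsP[[u v] /= [uU vU ->]].
by apply: subalg_closed; apply: (subvP UB); apply: vbasis_mem.
Qed.

Lemma generates_exists (X : seq L) : exists A : subalgebra L, generates X A.
Proof.
suff H k (U : {vspace L}) : (\dim {:L} - \dim U < k)%N ->
    exists A : subalgebra L,
      (U <= A)%VS /\ forall B : subalgebra L, (U <= B)%VS -> (A <= B)%VS.
  have [A [XA minA]] := H _ <<X>>%VS (ltnSn _).
  exists A; split; first by apply/span_subvP.
  by move=> B /span_subvP; apply: minA.
elim: k U => // k IHk U dimU.
have [/eqP sUU | ltU] := boolP (U == step U).
  have cU : is_subalg U by move=> x y xU yU; rewrite sUU step_lbz.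
  by exists (Subalgebra cU); split=> //=; apply: subvv.
have sU : (U <= step U)%VS by apply: addvSl.
have dU : (\dim U < \dim (step U))%N.
  by rewrite ltnNge; apply: contra ltU => le; rewrite eqEdim sU le.
have dL : (\dim (step U) <= \dim {:L})%N by apply/dimvS/subvf.
have [|A [sA minA]] := IHk (step U).
  rewrite -ltnS; apply: leq_trans dimU.
  by rewrite ltnS ltn_sub2l // (leq_trans dU dL).
exists A; split; first exact: subv_trans sU sA.
by move=> B UB; apply/minA/step_min.
Qed.

End Existence.

(* Main.v *)
Require Import Defs.
From HB Require Import structures.
From mathcomp Require Import all_boot all_order all_algebra.
From Stdlib Require Import Classical.

(** The argument works over every infinite field in which 2 is invertible.
    Write [L_x] for the operator [y |-> xy].

    Since [x] and [y] lie in a common supersolvable subalgebra, [y] is killed by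
    a product of operators [L_x - l].  So every [L_x] has all its eigenvalues in
    the field, and [L] is the sum of the generalised eigenspaces [L_l(x)]
    ([geigen_sum]).  Because [L_x] is a derivation, [L_l(x) L_m(x)] lies in
    [L_(l+m)(x)] ([geigen_mul]).  The source of everything below is that a
    subalgebra containing [x] and a sum of vectors from different eigenspaces of
    [x] contains each of these vectors ([geigen_component]): two generators are as
    good as [x] together with one vector from each eigenspace.  On a
    supersolvable subalgebra [A], each nonzero vector [c] has a weight: a linear
    form on [A] which vanishes on products, and whose value at [z] is an
    eigenvalue of [L_z] on every [z]-stable subspace containing [c]
    ([flagged_weight]).

    Choose [x] with the largest possible number of distinct nonzero eigenvalues,
    and let [H = L_0(x)].  One may replace [x] by its component in [H], which
    acts in the same way.  For [h] in [H], if [L_h] has an eigenvalue [b] on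
    [L_l(x)], then [x + t h] has the eigenvalue [l + t b]; for all but finitely
    many [t] these values are distinct, so by maximality [L_h] has just one
    eigenvalue on each [L_l(x)], and that one is 0 when [l = 0]
    ([eigen_unique]).  For fixed [l] this eigenvalue is additive in [h]
    ([eigD]).

    It follows that [L_ab] is nilpotent on [L] whenever [a] and [b] belong to
    eigenspaces of [x] ([nil_mul]): if [a] and [b] have opposite nonzero
    eigenvalues, then [L_ab] is nilpotent on any third eigenvector [c] inside
    the subalgebra generated by [x] and [a + b + c], and on the eigenspaces of
    [a] and [b] because its only eigenvalue there is seen on [a], respectively
    [b].  The vectors of the [L_l(x)] that act nilpotently are thus closed under
    the product, and their span contains all products.  Jacobson's theorem on
    weakly closed sets of nilpotent operators ([engel_jacobson]) then shows that
    the products [yz] act by 0 on some nonzero vector of every nonzero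
    subquotient of [L] ([derived_triangular]).

    On such vectors the operators [L_x] commute, and their eigenvalues are in
    the field, so they have a common eigenvector ([common_eigenvector]).  Given
    an ideal [I], let [K] consist of the [v] with [vz] in [I] for all [z].  If
    [K] is not contained in [I], a common eigenvector modulo [I] taken in [K]
    spans with [I] a larger ideal.  If [K] is contained in [I], the identity
    [(xv + vx)z = 0] gives [vx = - xv] modulo [I] for all [v], and any common
    eigenvector will do ([ideal_step]).  This builds the required chain. *)

(** * Generalised eigenspaces of left multiplications *)

Section Eigenspaces.
Set Implicit Arguments.
Unset Strict Implicit.
Import GRing.Theory.
Local Open Scope ring_scope.

Variables (F : fieldType) (L : leibnizType F).
Implicit Types (x y z u v w h : L) (a l m : F) (P Q U : L -> Prop).

(** A subspace of [L] given as a predicate, so that no finiteness or decidability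
    needs to be checked when it is defined by a condition. *)
Definition lin P := P 0 /\ forall a u v, P u -> P v -> P (a *: u + v).
Definition stable x P := forall v, P v -> P (lbz x v).

Lemma lin0 P : lin P -> P 0. Proof. by case. Qed.
Lemma linD P u v : lin P -> P u -> P v -> P (u + v).
Proof. by move=> [_ H] /H{}H /H; move/(_ 1); rewrite scale1r. Qed.
Lemma linZ P a u : lin P -> P u -> P (a *: u).
Proof. by move=> [P0 H] /H{}H; move: (H a _ P0); rewrite addr0. Qed.
Lemma linN P u : lin P -> P u -> P (- u).
Proof. by rewrite -scaleN1r => + Pu; move/linZ; apply. Qed.
Lemma linB P u v : lin P -> P u -> P v -> P (u - v).
Proof. by move=> lP Pu Pv; apply: linD => //; apply: linN. Qed.
Lemma lin_sum P (I : eqType) (r : seq I) (g : I -> L) :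
  lin P -> (forall i, i \in r -> P (g i)) -> P (\sum_(i <- r) g i).
Proof.
move=> lP Pg; rewrite big_seq.
by apply: (big_ind P); [exact: lin0 | move=> u v; exact: linD | ].
Qed.
Lemma lin_vspace (V : {vspace L}) : lin (fun v => v \in V).
Proof. by split=> [|a u v Vu Vv]; rewrite ?mem0v // memvD ?memvZ. Qed.
Lemma lin_span P (X : seq L) v :
  lin P -> (forall t, t \in X -> P t) -> v \in <<X>>%VS -> P v.
Proof.
move=> lP PX vX; rewrite (coord_span (X := in_tuple X) vX).
by apply: lin_sum => // i _; apply: linZ => //; apply: PX; rewrite mem_nth.
Qed.
Lemma linI P Q : lin P -> lin Q -> lin (fun v => P v /\ Q v).
Proof.
move=> lP lQ; split=> [|a u v [Pu Qu] [Pv Qv]]; first by split; apply: lin0.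
by split; apply: linD => //; apply: linZ.
Qed.

Lemma lbz0l y : lbz 0 y = 0 :> L.
Proof. by have := lbz_linearl y (-1) 0 0; rewrite scaler0 addr0 scaleN1r addNr. Qed.
Lemma lbz0r x : lbz x 0 = 0 :> L.
Proof. by have := lbz_linearr x (-1) 0 0; rewrite scaler0 addr0 scaleN1r addNr. Qed.
Lemma lbzZl a x y : lbz (a *: x) y = a *: lbz x y.
Proof. by have := lbz_linearl y a x 0; rewrite !addr0 lbz0l addr0. Qed.
Lemma lbzZr a x y : lbz x (a *: y) = a *: lbz x y.
Proof. by have := lbz_linearr x a y 0; rewrite !addr0 lbz0r addr0. Qed.
Lemma lbzDl x x' y : lbz (x + x') y = lbz x y + lbz x' y.
Proof. by have := lbz_linearl y 1 x x'; rewrite !scale1r. Qed.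
Lemma lbzDr x y y' : lbz x (y + y') = lbz x y + lbz x y'.
Proof. by have := lbz_linearr x 1 y y'; rewrite !scale1r. Qed.
Lemma lbzNl x y : lbz (- x) y = - lbz x y.
Proof. by rewrite -scaleN1r lbzZl scaleN1r. Qed.
Lemma lbzNr x y : lbz x (- y) = - lbz x y.
Proof. by rewrite -scaleN1r lbzZr scaleN1r. Qed.
Lemma lbzBl x x' y : lbz (x - x') y = lbz x y - lbz x' y.
Proof. by rewrite lbzDl lbzNl. Qed.
Lemma lbzBr x y y' : lbz x (y - y') = lbz x y - lbz x y'.
Proof. by rewrite lbzDr lbzNr. Qed.
Lemma lbz_sumr (I : Type) (r : seq I) (g : I -> L) x :
  lbz x (\sum_(i <- r) g i) = \sum_(i <- r) lbz x (g i).
Proof. by apply: (big_morph (lbz x)) => [u v|]; rewrite ?lbzDr ?lbz0r. Qed.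
Lemma lbzA x y z : lbz (lbz x y) z = lbz x (lbz y z) - lbz y (lbz x z).
Proof. by rewrite lbz_leibniz addrK. Qed.

Lemma stable_linl P v : lin P -> lin (fun x => P (lbz x v)).
Proof.
move=> lP; split=> [|a x y Px Py]; first by rewrite lbz0l; apply: lin0.
by rewrite lbzDl lbzZl; apply: linD => //; apply: linZ.
Qed.

(** The operator [L_x - l]. *)
Definition lsub x l v := lbz x v - l *: v.

(** [v] lies in the generalised eigenspace [L_l(x)] of [L_x]; in particular
    [geigen x 0 v] says that [L_x] acts nilpotently on [v], and 0 lies in every
    [L_l(x)]. *)
Definition geigen x l v := exists k, iter k (lsub x l) v = 0.

Lemma lsub0 x l : lsub x l 0 = 0. Proof. by rewrite /lsub lbz0r scaler0 subrr. Qed.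
Lemma lsubD x l u v : lsub x l (u + v) = lsub x l u + lsub x l v.
Proof. by rewrite /lsub lbzDr scalerDr opprD addrACA. Qed.
Lemma lsubZ x l a u : lsub x l (a *: u) = a *: lsub x l u.
Proof. by rewrite /lsub lbzZr scalerBr !scalerA mulrC. Qed.
Lemma lsubC x l m u : lsub x l (lsub x m u) = lsub x m (lsub x l u).
Proof.
rewrite /lsub !lbzBr !lbzZr !scalerBr !scalerA [m * l]mulrC !opprB -!addrA.
by congr (_ + _); rewrite addrCA [RHS]addrCA [X in _ + X]addrC.
Qed.
Lemma iter_lsub0 x l k : iter k (lsub x l) 0 = 0.
Proof. by elim: k => //= k ->; rewrite lsub0. Qed.
Lemma iter_lsubD x l k u v :
  iter k (lsub x l) (u + v) = iter k (lsub x l) u + iter k (lsub x l) v.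
Proof. by elim: k => //= k ->; rewrite lsubD. Qed.
Lemma iter_lsubZ x l k a u : iter k (lsub x l) (a *: u) = a *: iter k (lsub x l) u.
Proof. by elim: k => //= k ->; rewrite lsubZ. Qed.
Lemma iter_lsub_ge x l k n u :
  iter k (lsub x l) u = 0 -> (k <= n)%N -> iter n (lsub x l) u = 0.
Proof. by move=> uk /subnK <-; rewrite iterD uk iter_lsub0. Qed.

Lemma lin_geigen x l : lin (geigen x l).
Proof.
split=> [|a u v [k uk] [n vn]]; first by exists 0.
exists (k + n)%N; rewrite iter_lsubD iter_lsubZ (iter_lsub_ge uk) ?leq_addr //.
by rewrite (iter_lsub_ge vn) ?leq_addl // scaler0 addr0.
Qed.

Lemma geigen_lsub x l v : geigen x l (lsub x l v) -> geigen x l v.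
Proof. by case=> k; rewrite -iterSr => vk; exists k.+1. Qed.
Lemma stable_lsub x l P v : lin P -> stable x P -> P v -> P (lsub x l v).
Proof. by move=> lP sP Pv; apply: linB => //; [apply: sP | apply: linZ]. Qed.
Lemma geigen_iter_lsub x l m k v : geigen x l v -> geigen x l (iter k (lsub x m) v).
Proof.
case=> n vn; exists n; elim: k => //= k IH.
have C j w : iter j (lsub x l) (lsub x m w) = lsub x m (iter j (lsub x l) w).
  by elim: j => //= j ->; rewrite lsubC.
by rewrite C IH lsub0.
Qed.
Lemma stable_geigen x l : stable x (geigen x l).
Proof.
move=> v gv; have -> : lbz x v = lsub x l v + l *: v by rewrite subrK.
apply: linD; [exact: lin_geigen | exact: (@geigen_iter_lsub x l l 1) | ].
by apply: linZ => //; exact: lin_geigen.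
Qed.

Lemma geigen_mul x l m u v :
  geigen x l u -> geigen x m v -> geigen x (l + m) (lbz u v).
Proof.
case=> k uk [n vn]; move: {2}(k + n)%N (leqnn (k + n)) => N.
have g0 := lin0 (lin_geigen x (l + m)).
elim: N k n u v uk vn => [|N IH] [|k] [|n] u v uk vn le_kn //;
  try by [rewrite (uk : u = 0) lbz0l | rewrite (vn : v = 0) lbz0r].
apply: geigen_lsub.
have -> : lsub x (l + m) (lbz u v) = lbz (lsub x l u) v + lbz u (lsub x m v).
  rewrite /lsub lbz_leibniz lbzBl lbzBr lbzZl lbzZr scalerDl opprD.
  by rewrite addrACA.
apply: linD; first exact: lin_geigen.
- by apply: IH vn _; [rewrite iterSr in uk; exact: uk | ].
- by apply: IH uk _ _; [rewrite iterSr in vn; exact: vn | rewrite addnS in le_kn].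
Qed.

Lemma geigen_stable0 x h l : geigen x 0 h -> stable h (geigen x l).
Proof. by move=> xh v xv; rewrite -[l]add0r; apply: geigen_mul. Qed.

(** On [L_l(x)] the operator [L_x - m] is invertible for [m != l], with an inverse
    polynomial in [L_x]; hence it reflects membership in stable subspaces. *)
Lemma geigen_reflect x l m P v : lin P -> stable x P -> l != m ->
  geigen x l v -> P (lsub x m v) -> P v.
Proof.
move=> lP sP lm [k]; elim: k v => [|k IH] v; first by move=> /= -> _; apply: lin0.
rewrite iterSr => vk Pv.
have Pv' : P (lsub x l v) by apply: IH => //; rewrite lsubC; apply: stable_lsub.
have -> : v = (l - m)^-1 *: (lsub x m v - lsub x l v).
  rewrite /lsub opprB [X in _ *: X]addrC addrA subrK -scalerBl scalerA.
  by rewrite mulVf ?scale1r // subr_eq0.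
by apply: linZ => //; apply: linB.
Qed.

Lemma geigen_inj x l m v : geigen x l v -> geigen x m v -> v != 0 -> l = m.
Proof.
move=> gl [k vk] v0; apply/eqP; apply: contraNT v0 => lm; apply/eqP.
have lP : lin (fun v => v = 0 :> L).
  by split=> // a u w -> ->; rewrite scaler0 addr0.
elim: k v gl vk => // k IH v gl; rewrite iterSr => vk.
apply: (geigen_reflect lP _ lm gl) => [w ->|]; first by rewrite lbz0r.
by apply: IH => //; apply: (@geigen_iter_lsub x l m 1).
Qed.

(** A stable subspace containing a sum of vectors from distinct generalised
    eigenspaces contains each of them. *)
Lemma geigen_component x P (E : seq F) (g : F -> L) :
  lin P -> stable x P -> uniq E -> (forall l, l \in E -> geigen x l (g l)) ->
  P (\sum_(l <- E) g l) -> forall l, l \in E -> P (g l).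
Proof.
move=> lP sP; elim: E g => // l E IH g /= /andP[lE uE] gg.
rewrite big_cons => Pg.
have [k gk] := gg l (mem_head _ _).
(* [(L_x - l)^k] kills [g l] and leaves a sum over [E]. *)
have PE m : m \in E -> P (g m).
  move=> mE; have ml : m != l by apply: contraNneq lE => <-.
  have gm := gg m (mem_behead (s := l :: E) mE).
  have: P (iter k (lsub x l) (g m)).
    apply: (IH (fun m => iter k (lsub x l) (g m))) => // [n nE|].
      by apply: geigen_iter_lsub; apply: gg; rewrite inE nE orbT.
    have -> : \sum_(m <- E) iter k (lsub x l) (g m) =
              iter k (lsub x l) (g l + \sum_(m <- E) g m).
      rewrite iter_lsubD gk add0r.
      by rewrite (big_morph _ (iter_lsubD x l k) (iter_lsub0 x l k)).
    by elim: k {gk} => //= k IHk; apply: stable_lsub.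
  elim: k {gk} => //= k IHk Pk; apply: IHk.
  exact: geigen_reflect lP sP ml (geigen_iter_lsub _ _ gm) Pk.
move=> m; rewrite inE => /predU1P[->|/PE//].
rewrite -[g l](addrK (\sum_(m <- E) g m)); apply: linB => //.
exact: lin_sum.
Qed.

Lemma geigen_solve x l m v : l != m -> geigen x l v ->
  exists2 z, geigen x l z & lsub x m z = v.
Proof.
move=> lm [k]; elim: k v => [|k IH] v /=.
  by move=> ->; exists 0; [apply: lin0 (lin_geigen _ _) | rewrite lsub0].
rewrite -/(iter k.+1 _ _) iterSr => vk; have [z gz zv] := IH _ vk.
exists ((l - m)^-1 *: (v - z)).
  apply: linZ; first exact: lin_geigen.
  by apply: linB => //; [apply: lin_geigen | exists k.+1; rewrite iterSr].
have dB : lsub x m (v - z) = lsub x m v - lsub x m z.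
  by rewrite lsubD -scaleN1r lsubZ scaleN1r.
rewrite lsubZ dB zv /lsub opprB [X in _ *: X]addrC addrA subrK -scalerBl scalerA.
by rewrite mulVf ?scale1r // subr_eq0.
Qed.

Lemma geigen_decomp x (s : seq F) v : foldr (lsub x) v s = 0 ->
  exists E g, [/\ uniq E, forall l, l \in E -> geigen x l (g l)
                & v = \sum_(l <- E) g l].
Proof.
(* The factors commute, so the last one may be taken to act first. *)
have -> : foldr (lsub x) v s = foldl (fun v l => lsub x l v) v s.
  have C l w (r : seq F) :
      foldr (lsub x) (lsub x l w) r = lsub x l (foldr (lsub x) w r).
    by elim: r => //= m r ->; rewrite lsubC.
  by elim: s v => //= l s IH v; rewrite -C IH.
elim: s v => /= [|m s IH] v.
  by move=> ->; exists [::], (fun=> 0); split=> //; rewrite big_nil.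
case/IH=> E [g [uE gg def]].
have /fin_all_exists[] : forall i : 'I_(size E), exists z,
    E`_i != m -> geigen x E`_i z /\ lsub x m z = g E`_i.
  move=> i; case: (eqVneq E`_i m) => [->|ne]; first by exists 0.
  have [z gz zv] := geigen_solve ne (gg _ (mem_nth 0 (ltn_ord i))).
  by exists z.
move=> f fP.
have [h hP] : exists h : F -> L, forall l, l \in E -> l != m ->
    geigen x l (h l) /\ lsub x m (h l) = g l.
  exists (fun l => if insub (index l E) is Some i then f i else 0) => l lE lm.
  case: insubP => [i _ iE|]; last by rewrite index_mem lE.
  by have := fP i; rewrite iE nth_index //; apply.
(* [lsub x m v] is the sum of the [g l], each of which with [l != m] is in the
   image of [L_x - m]; after subtracting preimages, [r] is left in [L_m(x)]. *)
pose E' := filter (predC1 m) E.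
have hE' l : l \in E' -> geigen x l (h l).
  by rewrite mem_filter => /andP[lm lE]; case: (hP l lE lm).
pose r := v - \sum_(l <- E') h l.
have gr : geigen x m r.
  apply: geigen_lsub; rewrite /r.
  have -> : lsub x m (v - \sum_(l <- E') h l) = \sum_(l <- E | l == m) g l.
    rewrite lsubD -scaleN1r lsubZ scaleN1r def (bigID (pred1 m)) /=.
    rewrite (big_morph _ (lsubD x m) (lsub0 x m)) big_filter /=.
    rewrite [X in _ + X - _]big_seq_cond [X in _ - X]big_seq_cond.
    rewrite [X in _ - X](eq_bigr g) ?addrK // => l /andP[lE lm].
    by case: (hP l lE lm).
  rewrite big_seq_cond; apply: (big_ind (geigen x m)) => [||l /andP[lE /eqP <-]].
  - exact: lin0 (lin_geigen _ _).
  - by move=> a b; apply: linD (lin_geigen _ _).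
  - exact: gg.
exists (m :: E'), (fun l => if l == m then r else h l); split=> [|l|].
- by rewrite /= mem_filter /= eqxx filter_uniq.
- rewrite inE; case: eqVneq => [->//|lm /=]; exact: hE'.
rewrite big_cons eqxx big_seq (eq_bigr h) -?big_seq ?subrK //.
by move=> l; rewrite mem_filter /= => /andP[/negbTE ->].
Qed.

Lemma dim_add_line (V : {vspace L}) e : e \notin V ->
  \dim (V + <[e]>)%VS = (\dim V).+1.
Proof.
move=> eV; have e0 : e != 0 by apply: contraNneq eV => ->; apply: mem0v.
rewrite dimv_disjoint_sum ?dim_vline ?e0 ?addn1 //.
apply/eqP; rewrite -subv0; apply/subvP=> v; rewrite memv_cap memv0.
case/andP=> vV /vlineP[a def]; rewrite def in vV *.
have [->|a0] := eqVneq a 0; first by rewrite scale0r.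
by case/negP: eV; rewrite -[e]scale1r -(mulVf a0) -scalerA memvZ.
Qed.

Lemma size_spectrum x (E : seq F) : uniq E ->
  (forall l, l \in E -> exists2 v, v != 0 & geigen x l v) ->
  (size E <= \dim {:L})%N.
Proof.
move=> uE hE; suff [V [_ dV]] : exists V : {vspace L},
    (forall v, v \in V -> exists2 g, forall l, l \in E -> geigen x l (g l)
                                   & v = \sum_(l <- E) g l) /\
    (size E <= \dim V)%N by exact: leq_trans dV (dimvS (subvf V)).
elim: E uE hE => [_ _|l E IH /= /andP[lE uE] hE].
  exists 0%VS; split=> // v; rewrite memv0 => /eqP ->.
  by exists (fun=> 0); rewrite ?big_nil.
have [|V [VE dV]] := IH uE; first by move=> m mE; apply: hE; rewrite inE mE orbT.
have [e e0 ge] := hE l (mem_head _ _).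
have eV : e \notin V.
  apply: contra e0 => /VE[g gg def].
  pose g' m := if m == l then - e else g m.
  have g'E : \sum_(m <- E) g' m = e.
    rewrite def big_seq [RHS]big_seq; apply: eq_bigr => m mE.
    by rewrite /g' (negPf (contraNneq _ lE)) // => <-.
  have lP : lin (fun v => v = 0 :> L).
    by split=> // a u w -> ->; rewrite scaler0 addr0.
  have: g' l = 0.
    apply: (@geigen_component x (fun v => v = 0) (l :: E)); rewrite ?mem_head //=.
    - by move=> v ->; rewrite lbz0r.
    - by rewrite lE.
    - move=> m; rewrite inE /g'; case: eqVneq => [-> _|_ /= /gg//].
      by apply: linN => //; apply: lin_geigen.
    by rewrite big_cons g'E /g' eqxx addNr.
  by rewrite /g' eqxx => /eqP; rewrite oppr_eq0.
exists (V + <[e]>)%VS; split.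
  move=> v /memv_addP[v1 /VE[g gg ->] [_ /vlineP[a ->] ->]].
  exists (fun m => if m == l then a *: e else g m) => [m|].
    rewrite inE; case: eqVneq => [-> _|_ /= /gg//].
    by apply: linZ => //; apply: lin_geigen.
  rewrite big_cons eqxx addrC big_seq [in RHS]big_seq; congr (_ + _).
  by apply: eq_bigr => m mE; rewrite (negPf (contraNneq _ lE)) // => <-.
by rewrite dim_add_line.
Qed.

(** * Weakly closed sets of nilpotent left multiplications *)

(** The operators [L_t], for [t] satisfying [S], all annihilate some nonzero vector
    of every nonzero stable subquotient [U / U'].  The upper set [U] need only be stable,
    not a subspace: this is used below with [U] a set of elements closed under
    the product. *)
Definition strictly_triangular (S : L -> Prop) :=
  forall U U' : L -> Prop, lin U' ->
    (forall t, S t -> stable t U) -> (forall t, S t -> stable t U') ->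
    (exists u, U u /\ ~ U' u) ->
    exists v, [/\ U v, ~ U' v & forall t, S t -> U' (lbz t v)].

(** [x] acts on [L] as some element of the span of [X]. *)
Definition acts_in (X : seq L) x :=
  exists2 t, t \in <<X>>%VS & forall v, lbz x v = lbz t v.

Lemma lin_acts_in X : lin (acts_in X).
Proof.
split=> [|a u v [s sX us] [t tX vt]].
  by exists 0; rewrite ?mem0v.
exists (a *: s + t) => [|w]; first by rewrite memvD ?memvZ.
by rewrite !lbzDl !lbzZl us vt.
Qed.

Lemma acts_in_stable X P s v :
  lin P -> (forall t, t \in X -> P (lbz t v)) -> acts_in X s -> P (lbz s v).
Proof.
move=> lP XP [t tX ->]; exact: lin_span (stable_linl v lP) XP tX.
Qed.

Lemma strictly_triangular_cons (X : seq L) s :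
  (forall v, geigen s 0 v) -> (forall t, t \in X -> acts_in X (lbz t s)) ->
  strictly_triangular (fun t => t \in X) ->
  strictly_triangular (fun t => t \in s :: X).
Proof.
move=> ns Xs GX U U' lU' sU sU' uU.
have sX t : t \in X -> t \in s :: X by rewrite inE orbC => ->.
have [||w [Uw nw Xw]] := GX U U' lU' _ _ uU.
- by move=> t /sX; apply: sU.
- by move=> t /sX; apply: sU'.
have [k] := ns w; elim: k w Uw nw Xw => [|k IH] w Uw nw Xw.
  by move=> /= w0; case: nw; rewrite w0; apply: lin0.
rewrite iterSr /lsub scale0r subr0 => wk.
have [U's|nU's] := classic (U' (lbz s w)).
  by exists w; split=> // t; rewrite inE => /predU1P[->|/Xw].
apply: IH wk => //; first by apply: sU; rewrite ?mem_head.
move=> t tX; rewrite lbz_leibniz; apply: linD => //.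
  by apply: acts_in_stable Xw (Xs t tX).
by apply: sU'; rewrite ?mem_head //; apply: Xw.
Qed.

(** Jacobson's theorem: a set of elements that is closed under the product and
    acts by nilpotent operators is strictly triangular.  Finite subsets [X] whose
    span is closed under the product, up to elements acting as 0, are enlarged
    one element at a time. *)
Theorem engel_jacobson (S : L -> Prop) :
  (forall s t, S s -> S t -> S (lbz s t)) ->
  (forall s, S s -> forall v, geigen s 0 v) -> strictly_triangular S.
Proof.
move=> Smul Snil.
suff H (d : nat) (X : seq L) : (\dim {:L} - \dim <<X>> < d)%N ->
    (forall t, t \in X -> S t) ->
    (forall s t, s \in X -> t \in X -> acts_in X (lbz s t)) ->
    strictly_triangular (fun t => t \in X) -> strictly_triangular S.
  apply: (H _ [::] (ltnSn _)) => // U U' _ _ _ [u [Uu nu]].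
  by exists u.
elim: d X => // d IH X dX XS Xmul GX.
have [all_in|] := classic (forall s, S s -> acts_in X s).
  move=> U U' lU' sU sU' uU.
  have [||v [Uv nv Xv]] := GX U U' lU' _ _ uU.
  - by move=> t /XS; apply: sU.
  - by move=> t /XS; apply: sU'.
  by exists v; split=> // t /all_in; apply: acts_in_stable.
move=> not_in.
(* Strict triangularity of [X] on the set [S] itself, modulo the elements that
   act as elements of the span of [X], gives [s] normalising [X]. *)
have [|||s [Ss ns Xs]] := GX S (acts_in X) (lin_acts_in X).
- by move=> t /XS St v; apply: Smul.
- move=> t tX v [u uX vu]; have [w wX tw] : acts_in X (lbz t u).
    apply: (lin_span (P := fun u => acts_in X (lbz t u)) _ _ uX) => [|r rX];
      last exact: Xmul.
    split=> [|a p q Pp Pq]; first by rewrite lbz0r; apply: lin0 (lin_acts_in _).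
    rewrite lbzDr lbzZr; apply: linD (lin_acts_in _) _ _ => //.
    exact: linZ (lin_acts_in _) _.
  by exists w => // p; rewrite -tw !lbzA !vu.
- have [s nSs] := not_all_ex_not _ _ not_in.
  by exists s; apply: imply_to_and.
have sub : (<<X>> <= <<s :: X>>)%VS by rewrite span_cons addvSr.
have up (r : L) : acts_in X r -> acts_in (s :: X) r.
  by case=> t tX at'; exists t => //; apply: (subvP sub).
apply: (IH (s :: X)).
- have lt : (\dim <<X>> < \dim <<s :: X>>)%N.
    rewrite ltnNge; apply/negP => le.
    have /eqP eq : (<<X>> == <<s :: X>>)%VS by rewrite eqEdim sub le.
    by case: ns; exists s => //; rewrite eq memv_span ?mem_head.
  rewrite -ltnS; apply: leq_trans dX; rewrite ltnS ltn_sub2l //.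
  exact: leq_trans lt (dimvS (subvf _)).
- by move=> t; rewrite inE => /predU1P[->|/XS].
(* Here [ss] acts as 0, and [st] acts as [- ts]. *)
- move=> a b; rewrite !inE => /predU1P[->|aX] /predU1P[->|bX].
  + exists 0 => [|v]; first exact: mem0v.
    by rewrite lbzA subrr lbz0l.
  + have [t tX bs] := Xs b bX; exists (- t) => [|v].
      by rewrite memvN; apply: (subvP sub).
    by rewrite lbzNl -bs !lbzA opprB.
  + exact/up/Xs.
  + exact/up/Xmul.
- by apply: strictly_triangular_cons => //; apply: Snil.
Qed.
End Eigenspaces.

(** * Weights of supersolvable subalgebras *)

Section Weights.
Set Implicit Arguments.
Unset Strict Implicit.
Import GRing.Theory.
Local Open Scope ring_scope.

Variables (F : fieldType) (L : leibnizType F).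
Implicit Types (w : L -> F) (x y z u v h c : L) (a k l m : F) (P Q U : L -> Prop).
Implicit Types (A : {vspace L}).

(** [A] is a subalgebra with a complete flag of subspaces, each stable under left
    multiplication by [A]. *)
Definition flagged A := is_subalg A /\
  exists n (J : nat -> {vspace L}), [/\ J 0%N = 0%VS, J n = A,
    forall s, (s < n)%N -> (J s <= J s.+1)%VS /\ \dim (J s.+1) = (\dim (J s)).+1
  & forall s, (s <= n)%N -> forall u v, u \in A -> v \in J s -> lbz u v \in J s].

Lemma add_line A B c : (A <= B)%VS -> \dim B = (\dim A).+1 ->
  c \in B -> c \notin A -> B = (A + <[c]>)%VS.
Proof.
move=> AB dB cB cA; have sub : (A + <[c]> <= B)%VS by rewrite subv_add AB -memvE.
apply/esym/eqP; rewrite eqEdim sub dB ltnNge; apply: contra cA => le.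
have /eqP -> : A == (A + <[c]>)%VS by rewrite eqEdim addvSl.
exact: (subvP (addvSr _ _)) (memv_line c).
Qed.

Lemma line_scalar A B c u : (A <= B)%VS -> \dim B = (\dim A).+1 ->
  c \in B -> c \notin A -> u \in B -> exists k, u - k *: c \in A.
Proof.
move=> AB dB cB cA; rewrite (add_line AB dB cB cA).
by case/memv_addP=> a aA [_ /vlineP[k ->] ->]; exists k; rewrite addrK.
Qed.

Lemma flagged_split A x y : flagged A -> x \in A -> y \in A ->
  exists s, foldr (lsub x) y s = 0.
Proof.
case=> _ [n [J [J0 Jn Js JA]]] xA; rewrite -{1}Jn.
elim: n y {Jn} Js JA => [|n IH] y Js JA yJ.
  by exists [::] => /=; apply/eqP; rewrite -memv0 -J0.
have {}IH z : z \in J n -> exists s, foldr (lsub x) z s = 0.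
  by apply: IH => s ls; [apply: Js | apply: JA]; apply: leqW.
have [/IH//|yn] := boolP (y \in J n).
have [sub dim] := Js _ (ltnSn n).
have [k /IH[s sk]] := line_scalar sub dim yJ yn (JA _ (leqnn _) _ _ xA yJ).
by exists (rcons s k); rewrite foldr_rcons.
Qed.

(** [w] is a weight of [A] at [c].  Only the values of [w] on [A] matter. *)
Definition weight A c (w : L -> F) :=
  [/\ forall a u v, u \in A -> v \in A -> w (a *: u + v) = a * w u + w v,
      forall u v, u \in A -> v \in A -> w (lbz u v) = 0
    & forall z U, z \in A -> lin U -> stable z U -> U c ->
        exists v, [/\ U v, v != 0 & geigen z (w z) v]].

(** If [J s.+1] is the first step of the flag containing [c], the weight at [c] is
    the scalar by which [A] acts on [J s.+1 / J s]. *)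
Lemma flagged_weight A c : flagged A -> c \in A -> c != 0 ->
  exists w, weight A c w.
Proof.
move=> fA cA c0; have [sA [n [J [J0 Jn Js JA]]]] := fA.
have [s [sn cs cs1]] : exists s, [/\ (s < n)%N, c \notin J s & c \in J s.+1].
  have: c \in J n by rewrite Jn.
  elim: n {Jn} Js JA => [|n IH] Js JA cn.
    by rewrite J0 memv0 (negPf c0) in cn.
  have [cn'|cn'] := boolP (c \in J n); last by exists n.
  have [||s [sn ? ?]] := IH _ _ cn'; last by exists s; split=> //; apply: leqW.
  - by move=> s sn; apply: Js; apply: leqW.
  - by move=> s sn; apply: JA; apply: leqW.
have [sub dim] := Js s sn.
have wex u : exists k, (u \in A) ==> (lbz u c - k *: c \in J s).
  have [uA|uA] := boolP (u \in A); last by exists 0.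
  exact: line_scalar sub dim cs1 cs (JA _ sn _ _ uA cs1).
pose w u := xchoose (wex u).
have wP u : u \in A -> lbz u c - w u *: c \in J s.
  by move=> uA; have /implyP := xchooseP (wex u); apply.
have w_uniq u k : u \in A -> lbz u c - k *: c \in J s -> w u = k.
  move=> uA ku; apply/eqP; apply: contraNT cs => ne.
  rewrite -subr_eq0 in ne; rewrite -[c]scale1r -(mulVf ne) -scalerA memvZ //.
  have := memvB ku (wP u uA); rewrite opprB addrC addrA subrK -scalerBl //.
exists w; split=> [a u v uA vA|u v uA vA|z U zA lU sU Uc].
- apply: w_uniq; first by rewrite memvD ?memvZ.
  rewrite lbzDl lbzZl scalerDl opprD addrACA -scalerA -scalerBr.
  by rewrite memvD ?memvZ ?wP.
- apply: w_uniq; first exact: sA.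
  rewrite scale0r subr0 lbzA.
  have H p q : p \in A -> q \in A ->
      lbz p (lbz q c) - w q *: (w p *: c) \in J s.
    move=> pA qA; rewrite -[lbz q c](subrK (w q *: c)) lbzDr lbzZr -addrA memvD //.
      by rewrite (JA s (ltnW sn)) ?wP.
    by rewrite -scalerBr memvZ ?wP.
  have := memvB (H _ _ uA vA) (H _ _ vA uA).
  by rewrite !scalerA mulrC opprB addrA subrK.
have [r rc] := flagged_split fA zA cA.
have [E [g [uE gg def]]] := geigen_decomp rc.
have gU : forall l, l \in E -> U (g l).
  by apply: (@geigen_component _ _ z) => //; rewrite -def.
(* Otherwise [w z] is not an eigenvalue of [L_z] on [U], so [L_z - w z] is
   invertible there; as it maps [c] into [J s], it follows that [c] is in [J s]. *)
apply: NNPP => no; case/negP: cs; rewrite def.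
have stJ : stable z (fun v => v \in J s) by move=> v; apply: JA (ltnW sn) _ _ zA.
have lJ := lin_vspace (J s).
rewrite big_seq memv_suml // => l lE.
have [lw|lw] := eqVneq l (w z).
  have [->|gl0] := eqVneq (g l) 0; first exact: mem0v.
  by case: no; exists (g l); rewrite -lw; split; [apply: gU | | apply: gg].
apply: (geigen_reflect lJ stJ lw (gg l lE)).
apply: (geigen_component (g := fun l => lsub z (w z) (g l)) lJ stJ uE) lE.
  by move=> m mE; apply: (@geigen_iter_lsub _ _ _ _ _ 1); apply: gg.
by rewrite -(big_morph _ (lsubD z (w z)) (lsub0 z (w z))) -def wP.
Qed.

Lemma weight_eq A c w z k : weight A c w -> z \in A -> geigen z k c -> w z = k.
Proof.
move=> [_ _ wU] zA zc.
have [v [v1 v0 v2]] := wU z _ zA (lin_geigen z k) (@stable_geigen _ _ z k) zc.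
exact: geigen_inj v2 v1 v0.
Qed.

Lemma weightD A c w u v :
  weight A c w -> u \in A -> v \in A -> w (u + v) = w u + w v.
Proof. by move=> [wl _ _] uA vA; rewrite -{1}[u]scale1r wl // mul1r. Qed.
Lemma weight0 A c w : weight A c w -> w 0 = 0.
Proof. by move=> [_ w0 _]; rewrite -(lbz0l (0 : L)) w0 ?mem0v. Qed.
Lemma weightZ A c w a u : weight A c w -> u \in A -> w (a *: u) = a * w u.
Proof.
move=> ww uA; have [wl _ _] := ww.
by rewrite -[a *: u]addr0 wl ?mem0v // (weight0 ww) addr0.
Qed.

(** An element at which all weights vanish acts nilpotently. *)
Lemma flagged_nil A u : flagged A -> u \in A ->
  (forall c w, c \in A -> c != 0 -> weight A c w -> w u = 0) ->
  forall c, c \in A -> geigen u 0 c.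
Proof.
move=> fA uA w0 c cA.
have [r rc] := flagged_split fA uA cA.
have [E [g [uE gg def]]] := geigen_decomp rc.
have gA : forall l, l \in E -> g l \in A.
  apply: (geigen_component (lin_vspace A) _ uE gg); last by rewrite -def.
  by move=> v; apply: fA.1.
rewrite def; apply: lin_sum; first exact: lin_geigen.
move=> l lE; have [->|gl0] := eqVneq (g l) 0; first exact: lin0 (lin_geigen _ _).
have [w ww] := flagged_weight fA (gA l lE) gl0.
have := w0 _ _ (gA l lE) gl0 ww; rewrite (weight_eq ww uA (gg l lE)) => l0.
by have := gg l lE; rewrite {1}l0.
Qed.

Lemma weight_geigen A c w x u l : weight A c w -> x \in A -> u \in A ->
  is_subalg A -> geigen x l u -> l != 0 -> w u = 0.
Proof.
move=> ww xA uA sA [k uk] l0.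
suff: w (iter k (lsub x l) u) = (- l) ^+ k * w u.
  rewrite uk (weight0 ww) => /esym/eqP; rewrite mulf_eq0 expf_eq0 oppr_eq0.
  by rewrite (negPf l0) andbF => /eqP.
have [wl w0 _] := ww.
suff [] : iter k (lsub x l) u \in A /\ w (iter k (lsub x l) u) = (- l) ^+ k * w u.
  by [].
elim: k {uk} => /= [|k [IA IH]]; first by rewrite mul1r.
split; first by rewrite memvB ?memvZ // sA.
by rewrite /lsub addrC -scaleNr wl ?sA // w0 ?sA // addr0 IH exprS mulrA.
Qed.

Lemma flagged_nil_mul A u v c : flagged A -> u \in A -> v \in A -> c \in A ->
  geigen (lbz u v) 0 c.
Proof.
move=> fA uA vA; apply: flagged_nil => //; first exact: fA.1.
by move=> d w _ _ [_ w0 _]; apply: w0.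
Qed.

Lemma flagged_nil_geigen A x u l c :
  flagged A -> x \in A -> u \in A -> geigen x l u -> l != 0 -> c \in A -> geigen u 0 c.
Proof.
move=> fA xA uA ux l0; apply: flagged_nil => // d w _ _ ww.
exact: weight_geigen ww xA uA fA.1 ux l0.
Qed.

End Weights.

(** * Eigenspaces of an element with the most eigenvalues *)

Section Regular.
Set Implicit Arguments.
Unset Strict Implicit.
Import GRing.Theory.
Local Open Scope ring_scope.

Variables (F : fieldType) (L : leibnizType F).
Implicit Types (w : L -> F) (x y z u v h c : L) (a k l m : F).
Implicit Types (P Q U : L -> Prop) (A : {vspace L}).

Hypothesis infF : forall s : seq F, exists t, t \notin s.
Hypothesis char2 : (2%:R : F) != 0.
Hypothesis locally_flagged :
  forall x y, exists A, [/\ x \in A, y \in A & flagged A].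

(** [L] is the sum of the generalised eigenspaces of each [L_x]. *)
Lemma geigen_sum x v : exists E g,
  [/\ uniq E, forall l, l \in E -> geigen x l (g l) & v = \sum_(l <- E) g l].
Proof.
have [A [xA vA fA]] := locally_flagged x v.
by have [s /geigen_decomp] := flagged_split fA xA vA.
Qed.

Lemma flagged_stable A x : flagged A -> x \in A -> stable x (fun v => v \in A).
Proof. by move=> fA xA v; apply: fA.1. Qed.

Lemma geigen_pair A x l m u v : flagged A -> x \in A -> l != m ->
  geigen x l u -> geigen x m v -> u + v \in A -> u \in A /\ v \in A.
Proof.
move=> fA xA lm gu gv uvA; have lA := lin_vspace A.
have H : forall n, n \in [:: l; m] -> (if n == l then u else v) \in A.
  apply: (geigen_component lA (flagged_stable fA xA)).
  - by rewrite /= inE lm.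
  - by move=> n; rewrite !inE; case: eqVneq => [->//|_ /= /eqP->].
  by rewrite !big_cons big_nil eqxx eq_sym (negPf lm) addr0.
split; first by have := H l; rewrite eqxx; apply; apply: mem_head.
by have := H m; rewrite eq_sym (negPf lm); apply; rewrite !inE eqxx orbT.
Qed.

Lemma geigen_triple A x l m n u v t : flagged A -> x \in A ->
  l != m -> l != n -> m != n -> geigen x l u -> geigen x m v -> geigen x n t ->
  u + v + t \in A -> [/\ u \in A, v \in A & t \in A].
Proof.
move=> fA xA lm ln mn gu gv gt uvtA; have lA := lin_vspace A.
have [ml [nl nm]] : (m == l) = false /\ (n == l) = false /\ (n == m) = false.
  by rewrite ![_ == l]eq_sym [n == m]eq_sym !(negPf lm, negPf ln, negPf mn).
have H : forall p, p \in [:: l; m; n] ->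
    (if p == l then u else if p == m then v else t) \in A.
  apply: (geigen_component lA (flagged_stable fA xA)).
  - by rewrite /= !inE (negPf lm) (negPf ln) (negPf mn).
  - move=> p; rewrite !inE; case: eqVneq => [->//|_ /=].
    by case: eqVneq => [->//|_ /= /eqP->].
  by rewrite !big_cons big_nil !eqxx ml nl nm addr0 addrA.
split; [have := H l | have := H m | have := H n];
  by rewrite ?eqxx ?ml ?nl ?nm; apply; rewrite !inE eqxx ?orbT.
Qed.

Lemma geigen0l u v : u = 0 -> geigen u 0 v.
Proof. by move=> ->; exists 1%N; rewrite /= /lsub lbz0l scale0r subrr. Qed.

Lemma geigenZ a h k c : geigen h k c -> geigen (a *: h) (a * k) c.
Proof.
case=> n hn; exists n.
have -> : iter n (lsub (a *: h) (a * k)) c = a ^+ n *: iter n (lsub h k) c.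
  elim: n {hn} => [|n IH]; first by rewrite scale1r.
  rewrite !iterS IH lsubZ /lsub lbzZl exprSr -scalerA -scalerBr scalerA.
  by rewrite -scalerA.
by rewrite hn scaler0.
Qed.

(** [l] and [k] are generalised eigenvalues of [L_x] and [L_h] on one vector [c]
    which lies with [x] and [h] in a common flagged subalgebra.  The presence of
    all three in one such subalgebra makes [p l + q k] an eigenvalue of
    [p x + q h]. *)
Definition joint x h l k := exists A c,
  [/\ flagged A, x \in A, h \in A
    & [/\ c \in A, c != 0, geigen x l c & geigen h k c]].

Lemma joint_comb x h l k p q : joint x h l k ->
  exists2 v, v != 0 & geigen (p *: x + q *: h) (p * l + q * k) v.
Proof.
case=> A [c [fA xA hA [cA c0 xc hc]]].
have [w ww] := flagged_weight fA cA c0; have [wl _ wU] := ww.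
have zA : p *: x + q *: h \in A by rewrite memvD ?memvZ.
have [//|//|v [_ v0]] := wU _ (fun=> True) zA _ _ I.
rewrite (weightD ww) ?memvZ // !(weightZ _ ww) // (weight_eq ww xA xc).
by rewrite (weight_eq ww hA hc) => gv; exists v.
Qed.

Lemma joint_geigen x h l k c : geigen x 0 h -> l != 0 -> c != 0 -> geigen x l c ->
  geigen h k c -> joint x h l k.
Proof.
move=> xh l0 c0 xc hc; have [A [xA hcA fA]] := locally_flagged x (h + c).
have [hA cA] : h \in A /\ c \in A.
  by apply: geigen_pair xh xc hcA => //; rewrite eq_sym.
by exists A, c.
Qed.

(** For a suitable [t], the form [(a, b) |-> a + t b] separates a given finite set
    of pairs. *)
Lemma separate (s : seq (F * F)) : uniq s ->
  exists t, uniq [seq p.1 + t * p.2 | p <- s].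
Proof.
move=> us; pose bad := [seq (q.1 - p.1) / (p.2 - q.2) | p <- s, q <- s].
have [t tbad] := infF bad; exists t; rewrite map_inj_in_uniq //.
move=> [p1 p2] [q1 q2] ps qs /= e; apply/eqP; apply: contraNT tbad => ne.
apply/allpairsP; exists ((p1, p2), (q1, q2)); split=> //=.
have e' : t * (p2 - q2) = q1 - p1.
  by apply/eqP; rewrite mulrBr subr_eq addrAC eq_sym subr_eq -e addrC.
have [pq|pq] := eqVneq p2 q2; last by rewrite -e' mulfK // subr_eq0.
move: e'; rewrite pq subrr mulr0 => /esym/eqP; rewrite subr_eq0 => /eqP pq1.
by rewrite pq pq1 eqxx in ne.
Qed.

(** [E] is a list of distinct nonzero eigenvalues of [L_x]. *)
Definition spectral x (E : seq F) :=
  [/\ uniq E, 0 \notin E & forall l, l \in E -> exists2 v, v != 0 & geigen x l v].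

Lemma spectral_joint x h (s : seq (F * F)) : uniq s -> (0, 0) \notin s ->
  (forall p, p \in s -> joint x h p.1 p.2) ->
  exists y E, spectral y E /\ size E = size s.
Proof.
move=> us s0 sj.
(* Adding [(0, 0)] to the pairs keeps the values [a + t b] away from 0. *)
have [|t ut] := @separate ((0, 0) :: s); first by rewrite /= s0.
move: ut => /=; rewrite mulr0 addr0 => /andP[t0 ut].
exists (1 *: x + t *: h), [seq p.1 + t * p.2 | p <- s].
split; last by rewrite size_map.
split=> // l /mapP[p ps ->]; rewrite -[p.1]mul1r.
exact: joint_comb (sj p ps).
Qed.

Lemma geigen_ext x y l v :
  (forall u, lbz x u = lbz y u) -> geigen x l v -> geigen y l v.
Proof.
move=> e [n xn]; exists n; rewrite -xn; elim: n {xn} => //= n ->.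
by rewrite /lsub e.
Qed.

(** In a Leibniz algebra [xx] need not vanish, and [x] need not lie in [L_0(x)];
    but its component there acts as [x] does. *)
Lemma zero_part x : exists2 y, forall v, lbz y v = lbz x v & geigen x 0 y.
Proof.
have [E [g [uE gg def]]] := geigen_sum x x.
pose P v := exists k, forall u, lbz v u = k *: lbz x u.
have lP : lin P.
  split=> [|a u v [k uk] [n vn]]; first by exists 0 => u; rewrite lbz0l scale0r.
  exists (a * k + n) => t; rewrite lbzDl lbzZl uk vn scalerDl scalerA //.
have xP v : P v -> forall u, lbz (lbz x v) u = 0.
  by case=> k vk u; rewrite lbzA !vk lbzZr subrr.
have sP : stable x P by move=> v /xP xv; exists 0 => u; rewrite xv scale0r.
have gP : forall l, l \in E -> P (g l).
  apply: (geigen_component lP sP uE gg); rewrite -def.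
  by exists 1 => u; rewrite scale1r.
have g0 l : l \in E -> l != 0 -> forall u, lbz (g l) u = 0.
  move=> lE l0 u; have [k gk] := gg l lE.
  have : lbz (iter k (lsub x l) (g l)) u = (- l) ^+ k *: lbz (g l) u.
    have : P (g l) by apply: gP.
    elim: k (g l) {gk} => [|k IH] v Pv; first by rewrite scale1r.
    rewrite iterSr IH; last exact: stable_lsub.
    by rewrite /lsub lbzBl xP // sub0r lbzZl -scaleNr scalerA exprSr.
  rewrite gk lbz0l => /esym/eqP; rewrite scaler_eq0 expf_eq0 oppr_eq0.
  by rewrite (negPf l0) andbF => /eqP.
exists (\sum_(l <- E | l == 0) g l).
  move=> v; rewrite [in RHS]def [in RHS](bigID (pred1 0)) /= lbzDl.
  rewrite -[LHS]addr0; congr (_ + _); apply/esym; rewrite big_seq_cond.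
  apply: (big_ind (fun r => lbz r v = 0)) => [|u t|l /andP[lE]].
  - exact: lbz0l.
  - by rewrite lbzDl => -> ->; rewrite addr0.
  - by move=> l0; apply: g0.
rewrite big_seq_cond; apply: (big_ind (geigen x 0)) => [|u t|l /andP[lE /eqP <-]].
- exact: lin0 (lin_geigen _ _).
- exact: linD (lin_geigen _ _).
- exact: gg.
Qed.

(** The maximum exists because [size E <= \dim {:L}] by [size_spectrum]. *)
Lemma exists_maximal : exists x E, [/\ geigen x 0 x, spectral x E
  & forall y E', spectral y E' -> (size E' <= size E)%N].
Proof.
suff H (d : nat) x E : spectral x E -> (\dim {:L} - size E < d)%N ->
    exists x E, spectral x E /\
                forall y E', spectral y E' -> (size E' <= size E)%N.
  have s0 : spectral 0 [::] by split.
  have [x [E [sE mE]]] := H _ 0 [::] s0 (ltnSn _).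
  have [y yx xy] := zero_part x; have [uE E0 hE] := sE.
  exists y, E; split=> //; first by apply: geigen_ext xy.
  split=> // l /hE[v v0 xv]; exists v => //; apply: geigen_ext xv => //.
elim: d x E => // d IH x E sE dE.
have [mE|] := classic (forall y E', spectral y E' -> (size E' <= size E)%N).
  by exists x, E.
move=> no; have [y ny] := not_all_ex_not _ _ no.
have [E' nE'] := not_all_ex_not _ _ ny.
have [sE' /negP] := imply_to_and _ _ nE'; rewrite -ltnNge => lt.
apply: (IH y E' sE'); rewrite -ltnS; apply: leq_trans dE.
rewrite ltnS ltn_sub2l //; apply: leq_trans lt _.
by case: sE' => uE' _ hE'; apply: size_spectrum hE'.
Qed.

Section Maximal.
Variables (x : L) (E : seq F).
Hypothesis xx : geigen x 0 x.
Hypothesis sE : spectral x E.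
Hypothesis maxE : forall y E', spectral y E' -> (size E' <= size E)%N.

Lemma joint_exists h l c : geigen x 0 h -> l != 0 -> c != 0 -> geigen x l c ->
  exists k, joint x h l k.
Proof.
move=> xh l0 c0 xc; have [A [xA hcA fA]] := locally_flagged x (h + c).
have [hA cA] : h \in A /\ c \in A.
  by apply: geigen_pair xh xc hcA => //; rewrite eq_sym.
have [E' [g [uE gg def]]] := geigen_sum h c.
have lA := linI (lin_vspace A) (lin_geigen x l).
have sA : stable h (fun v => v \in A /\ geigen x l v).
  move=> v [vA vx]; split; [exact: fA.1 | exact: geigen_stable0].
have gA : forall k, k \in E' -> g k \in A /\ geigen x l (g k).
  by apply: (geigen_component lA sA uE gg); rewrite -def.
have [k kE gk] : exists2 k, k \in E' & g k != 0.
  apply: NNPP => no; case/eqP: c0; rewrite def big_seq big1 // => k kE.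
  by apply/eqP; apply: contraPT no => gk; case; exists k.
have [gkA gkx] := gA k kE.
by exists k, A, (g k); split=> //; split=> //; apply: gg.
Qed.

Lemma seq_choice (R : F -> F -> Prop) (s : seq F) :
  (forall l, l \in s -> exists k, R l k) ->
  exists b : F -> F, forall l, l \in s -> R l (b l).
Proof.
elim: s => [|m s IH] H; first by exists id.
have [|b bP] := IH; first by move=> l ls; apply: H; rewrite inE ls orbT.
have [k mk] := H m (mem_head _ _).
exists (fun l => if l == m then k else b l) => l.
by rewrite inE; case: eqVneq => [->|_ /bP].
Qed.

Lemma joint_unique h : geigen x 0 h -> exists2 b : F -> F, b 0 = 0 &
  forall l k, joint x h l k -> k = b l.
Proof.
move=> xh; have [uE E0 hE] := sE.
have [l lE|b bP] := @seq_choice (joint x h) E.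
  have [v v0 xv] := hE l lE; apply: joint_exists v0 xv => //.
  by apply: contraNneq E0 => <-.
exists (fun l => if l == 0 then 0 else b l) => [|l k jlk]; first by rewrite eqxx.
(* A nonzero pair outside [s] would make some [x + t h] have more eigenvalues than [x]. *)
pose s := [seq (m, b m) | m <- E].
have us : uniq s by rewrite map_inj_uniq // => p q [].
have s0 : (0, 0) \notin s by apply/mapP => -[m mE [m0 _]]; rewrite m0 mE in E0.
have [e|ne] := eqVneq (l, k) (0, 0); first by case: e => -> ->; rewrite eqxx.
have [/mapP[m mE [-> ->]]|lks] := boolP ((l, k) \in s).
  by rewrite (negPf (contraNneq _ E0)) // => <-.
have [|||y [E' [sE' szE']]] := @spectral_joint x h ((l, k) :: s).
- by rewrite /= lks.
- by rewrite inE negb_or s0 eq_sym ne.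
- by move=> p; rewrite inE => /predU1P[->//|/mapP[m mE ->]]; apply: bP.
by have := maxE sE'; rewrite szE' /= size_map ltnn.
Qed.

(** Unlike for a nonzero eigenvalue of [x], a vector [c] of [L_0(x)] cannot be
    separated from [h] by [x].  Instead [x] is decomposed along [L_h]: either
    its component in [L_k(h)] is nonzero and serves as the vector, or [c] is a
    component of [c + x]. *)
Lemma joint_zero h k c : geigen x 0 h -> geigen x 0 c -> c != 0 -> k != 0 ->
  geigen h k c -> joint x h 0 k.
Proof.
move=> xh xc c0 k0 hc.
have [E' [g [uE gg def]]] := geigen_sum h x.
have sH := @geigen_stable0 _ _ x h 0 xh.
have gH : forall m, m \in E' -> geigen x 0 (g m).
  by apply: (geigen_component (lin_geigen x 0) sH uE gg); rewrite -def.
have [[kE gk]|nk] := classic (k \in E' /\ g k != 0).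
  have [A [xA hA fA]] := locally_flagged x h; have lA := lin_vspace A.
  exists A, (g k); split=> //; split=> //; [|exact: gH|exact: gg].
  by apply: (geigen_component lA (flagged_stable fA hA) uE gg) => //; rewrite -def.
pose g' m := if m == k then c else g m; pose E2 := [seq m <- E' | m != k].
have E2g m : m \in E2 -> g' m = g m.
  by rewrite mem_filter /g' => /andP[/negPf->].
have xE : x = \sum_(m <- E2) g' m.
  rewrite big_seq (eq_bigr _ E2g) -big_seq big_filter {1}def.
  rewrite (bigID (pred1 k)) /= big_seq_cond big1 ?add0r // => m /andP[mE /eqP mk].
  by apply/eqP; apply: contraPT nk => gm; case; rewrite -mk.
have [A [hA xcA fA]] := locally_flagged h (c + x); have lA := lin_vspace A.
have gA : forall m, m \in k :: E2 -> g' m \in A.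
  apply: (geigen_component lA (flagged_stable fA hA)).
  - by rewrite /= mem_filter eqxx filter_uniq.
  - move=> m; rewrite inE /g'; case: eqVneq => [->//|_ /=].
    by rewrite mem_filter => /andP[_ /gg].
  by rewrite big_cons -xE /g' eqxx.
have cA : c \in A by have := gA k (mem_head _ _); rewrite /g' eqxx.
by exists A, c; split=> //; rewrite -[x](addKr c) memvD // memvN.
Qed.

Lemma eigen_unique h : geigen x 0 h -> exists2 b : F -> F, b 0 = 0 &
  forall l c, geigen x l c -> geigen h (b l) c.
Proof.
move=> xh; have [b b0 bP] := joint_unique xh; exists b => // l c xc.
have [E' [g [uE gg def]]] := geigen_sum h c.
have sl := @geigen_stable0 _ _ x h l xh.
have gl : forall m, m \in E' -> geigen x l (g m).
  by apply: (geigen_component (lin_geigen x l) sl uE gg); rewrite -def.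
rewrite def; apply: lin_sum (lin_geigen _ _) _ => m mE.
have [->|gm0] := eqVneq (g m) 0; first exact: lin0 (lin_geigen _ _).
suff <- : m = b l by apply: gg.
have [l0|l0] := eqVneq l 0; last first.
  by apply: bP; apply: joint_geigen gm0 (gl m mE) (gg m mE).
have [->|m0] := eqVneq m 0; first by rewrite l0 b0.
apply: bP; rewrite l0; apply: joint_zero gm0 m0 (gg m mE) => //.
by rewrite -l0; apply: gl.
Qed.

(** [L_h] has no generalised eigenvalue other than [b] on [L_l(x)]. *)
Definition eig h l b := forall c, geigen x l c -> geigen h b c.

Lemma eig_eq h l b c k :
  eig h l b -> geigen x l c -> geigen h k c -> c != 0 -> b = k.
Proof. by move=> hb xc hc; apply: geigen_inj hc; apply: hb. Qed.

Lemma eigZ a h l b : eig h l b -> eig (a *: h) l (a * b).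
Proof. by move=> hb c xc; apply: geigenZ; apply: hb. Qed.

Lemma eig_lin a b h l k : geigen x 0 h -> l != 0 -> eig h l k ->
  eig (a *: x + b *: h) l (a * l + b * k).
Proof.
move=> xh l0 hk c xc.
have [->|c0] := eqVneq c 0; first exact: lin0 (lin_geigen _ _).
have xz : geigen x 0 (a *: x + b *: h).
  by apply: linD; [exact: lin_geigen | |]; apply: linZ => //; exact: lin_geigen.
have [e _ eP] := eigen_unique xz.
have [A [xA hcA fA]] := locally_flagged x (h + c).
have [hA cA] : h \in A /\ c \in A.
  by apply: geigen_pair xh xc hcA => //; rewrite eq_sym.
have [w ww] := flagged_weight fA cA c0.
have zA : a *: x + b *: h \in A by rewrite memvD ?memvZ.
suff <- : e l = a * l + b * k by apply: eP.
rewrite -(weight_eq ww zA (eP _ _ xc)) (weightD ww) ?memvZ //.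
rewrite !(weightZ _ ww) // (weight_eq ww xA xc).
by rewrite (weight_eq ww hA (hk _ xc)).
Qed.

(** For [h] in [L_0(x)], adding a multiple of [x] to [h] makes its eigenvalue on
    [L_l(x)] nonzero, so that it separates [L_l(x)] from [L_0(x)]. *)
Lemma perturb h c l : geigen x 0 h -> l != 0 -> geigen x l c ->
  exists s m, [/\ m != 0, geigen (s *: x + h) m c
    & forall d, geigen x 0 d -> geigen (s *: x + h) 0 d].
Proof.
move=> xh l0 xc; have [b b0 bP] := eigen_unique xh.
have [s sP] := infF [:: - b l / l].
exists s, (s * l + b l); split.
- apply: contraNneq sP => /eqP; rewrite addr_eq0 => /eqP e.
  by rewrite inE -e mulfK.
- have := @eig_lin s 1 h l (b l) xh l0 (bP l) c xc.
  by rewrite scale1r mul1r.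
move=> d xd; have xz : geigen x 0 (s *: x + h).
  by apply: linD; [exact: lin_geigen | apply: linZ => //; exact: lin_geigen |].
by have [e e0 eP] := eigen_unique xz; rewrite -e0; apply: eP.
Qed.

Lemma eigD (h k : L) l a b : geigen x 0 h -> geigen x 0 k -> l != 0 ->
  eig h l a -> eig k l b -> eig (h + k) l (a + b).
Proof.
move=> xh xk l0 ha kb c xc.
have [->|c0] := eqVneq c 0; first exact: lin0 (lin_geigen _ _).
have [s [m [m0 zc z0]]] := perturb xh l0 xc.
have lx := lin_geigen x 0.
have xhk : geigen x 0 (h + k) by apply: linD.
have xz : geigen x 0 (s *: x + h) by apply: linD => //; apply: linZ.
have [A [zA kcA fA]] := locally_flagged (s *: x + h) (k + c).
have [kA cA] : k \in A /\ c \in A.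
  by apply: geigen_pair (z0 _ xk) zc kcA => //; rewrite eq_sym.
have [w ww] := flagged_weight fA cA c0; have [wl _ _] := ww.
have [e _ eP] := eigen_unique xhk.
suff <- : e l = a + b by apply: eP.
have E1 : eig (s *: x + h) l (s * l + a).
  by have := @eig_lin s 1 h l a xh l0 ha; rewrite scale1r mul1r.
have E2 : eig (s *: x + h + k) l (s * l + e l).
  have := @eig_lin s 1 (h + k) l (e l) xhk l0 (eP l).
  by rewrite scale1r mul1r addrA.
have zkA : s *: x + h + k \in A by rewrite memvD.
apply: (addrI (s * l)); rewrite -(weight_eq ww zkA (E2 _ xc)) (weightD ww) //.
by rewrite (weight_eq ww zA (E1 _ xc)) (weight_eq ww kA (kb _ xc)) addrA.
Qed.

Lemma nil_zero h c : geigen x 0 h -> geigen x 0 c -> geigen h 0 c.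
Proof. by move=> xh xc; have [b <- bP] := eigen_unique xh; apply: bP. Qed.

Lemma eig_zero h l c :
  geigen x 0 h -> geigen x l c -> c != 0 -> geigen h 0 c -> eig h l 0.
Proof.
move=> xh xc c0 hc; have [b _ bP] := eigen_unique xh.
by rewrite -(eig_eq (bP l) xc hc c0); apply: bP.
Qed.

(** When [m = l], the product [ac] lies in [L_(2l)(x)], to which the case
    [m != l] applies. *)
Lemma nil_component (a : L) l m c :
  l != 0 -> geigen x l a -> geigen x m c -> geigen a 0 c.
Proof.
move=> l0 xa; wlog lm : m c / l != m => [H xc|xc].
  have [e|/H] := eqVneq l m; last exact.
  suff: geigen a 0 (lbz a c).
    by have := @geigen_lsub _ _ a 0 c; rewrite /lsub scale0r subr0.
  apply: (H (l + m)); last exact: geigen_mul.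
  by rewrite -e -subr_eq0 opprD addrA subrr sub0r oppr_eq0.
have [A [xA acA fA]] := locally_flagged x (a + c).
have [aA cA] : a \in A /\ c \in A by apply: geigen_pair xa xc acA.
exact: flagged_nil_geigen fA xA aA xa l0 cA.
Qed.

Lemma nil_opposite (a b : L) l m c : l != 0 -> geigen x l a -> geigen x (- l) b ->
  geigen x m c -> geigen (lbz a b) 0 c.
Proof.
move=> l0 xa xb xc; have xab : geigen x 0 (lbz a b).
  by rewrite -(subrr l); apply: geigen_mul.
have lNl : l != - l.
  by rewrite -addr_eq0 -mulr2n -mulr_natl mulf_neq0.
have [a0|a0] := eqVneq a 0; first by apply: geigen0l; rewrite a0 lbz0l.
have [b0|b0] := eqVneq b 0; first by apply: geigen0l; rewrite b0 lbz0r.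
have [A [xA abA fA]] := locally_flagged x (a + b).
have [aA bA] : a \in A /\ b \in A by apply: geigen_pair xa xb abA.
have [e|lm] := eqVneq l m.
  apply: (eig_zero xab xa a0); last by rewrite e.
  exact: (flagged_nil_mul fA aA bA aA).
have [e|Nlm] := eqVneq (- l) m.
  apply: (eig_zero xab xb b0); last by rewrite e.
  exact: (flagged_nil_mul fA aA bA bA).
have [B [xB abcB fB]] := locally_flagged x (a + b + c).
have [aB bB cB] : [/\ a \in B, b \in B & c \in B].
  by apply: geigen_triple xa xb xc abcB.
exact: (flagged_nil_mul fB aB bB cB).
Qed.

(** Both [(s x + h)g] and [xg] have the eigenvalue 0 on [L_m(x)], since each is a
    product inside a supersolvable subalgebra containing [c]; by additivity so
    does [hg]. *)
Lemma nil_zero_mul (h g : L) m c : geigen x 0 h -> geigen x 0 g -> geigen x m c ->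
  geigen (lbz h g) 0 c.
Proof.
move=> xh xg xc; have H0 u : geigen x 0 u -> geigen x 0 (lbz u g).
  by move=> xu; rewrite -[0](addr0 0); apply: geigen_mul.
have [e|m0] := eqVneq m 0; first by rewrite e in xc; apply: nil_zero xc; apply: H0.
have [->|c0] := eqVneq c 0; first exact: lin0 (lin_geigen _ _).
have H u n : geigen x 0 u -> geigen u 0 g -> geigen u n c -> n != 0 ->
    eig (lbz u g) m 0.
  move=> xu ug uc n0; have [A [uA gcA fA]] := locally_flagged u (g + c).
  have [gA cA] : g \in A /\ c \in A.
    by apply: geigen_pair ug uc gcA => //; rewrite eq_sym.
  apply: (eig_zero (H0 _ xu) xc c0); exact: (flagged_nil_mul fA uA gA cA).
have [s [n [n0 zc z0]]] := perturb xh m0 xc.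
have xz : geigen x 0 (s *: x + h).
  by apply: linD; [exact: lin_geigen | apply: linZ => //; exact: lin_geigen |].
have Ez := H _ _ xz (z0 _ xg) zc n0.
have Ex := eigZ (- s) (H _ _ xx xg xc m0).
have xg0 : geigen x 0 (- s *: lbz x g) by apply: linZ (lin_geigen _ _) _; apply: H0.
have := eigD (H0 _ xz) xg0 m0 Ez Ex; rewrite mulr0 addr0.
have -> : lbz (s *: x + h) g + - s *: lbz x g = lbz h g.
  by rewrite lbzDl lbzZl scaleNr addrC addKr.
exact.
Qed.

Lemma nil_mul (a b : L) l m v :
  geigen x l a -> geigen x m b -> geigen (lbz a b) 0 v.
Proof.
move=> xa xb; have [E' [g [_ gg ->]]] := geigen_sum x v.
apply: lin_sum (lin_geigen _ _) _ => n /gg{}gg.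
have [lm|lm] := eqVneq (l + m) 0; last
  exact: nil_component lm (geigen_mul xa xb) gg.
have [l0|l0] := eqVneq l 0.
  rewrite l0 add0r in lm; rewrite l0 in xa; rewrite lm in xb.
  exact: (nil_zero_mul xa xb gg).
by apply: (nil_opposite l0 xa _ gg); rewrite -[- l]addr0 -lm addKr.
Qed.

(** All products [yz] together annihilate a nonzero vector of every nonzero
    subquotient of the left module [L]. *)
Lemma derived_triangular U U' : lin U' -> (forall z, stable z U) ->
  (forall z, stable z U') -> (exists u, U u /\ ~ U' u) ->
  exists v, [/\ U v, ~ U' v & forall y z, U' (lbz (lbz y z) v)].
Proof.
move=> lU' sU sU' uU.
pose S u := (exists l, geigen x l u) /\ forall v, geigen u 0 v.
have [||||v [Uv nv Sv]] := @engel_jacobson F L S _ _ U U' lU' _ _ uU => //.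
- move=> a b [[l xa] _] [[m xb] _]; split.
    by exists (l + m); apply: geigen_mul.
  by move=> v; apply: nil_mul xa xb.
- by move=> a [].
exists v; split=> // y z.
have [E1 [f [_ ff ->]]] := geigen_sum x y.
have [E2 [g [_ gg ->]]] := geigen_sum x z.
have lS := stable_linl v lU'.
rewrite lbz_sumr; apply: (lin_sum (P := fun u => U' (lbz u v))) => // m /gg xg.
have l1 : lin (fun y => U' (lbz (lbz y (g m)) v)).
  split=> [|a u t Pu Pt]; first by rewrite !lbz0l; apply: lin0.
  by rewrite !lbzDl !lbzZl; apply: linD => //; apply: linZ.
apply: lin_sum l1 _ => l /ff xf; apply: Sv.
by split=> [|u]; [exists (l + m); apply: geigen_mul | apply: nil_mul xf xg].
Qed.

End Maximal.
End Regular.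

(** * The chain of ideals *)

Section Supersolvable.
Set Implicit Arguments.
Unset Strict Implicit.
Import GRing.Theory.
Local Open Scope ring_scope.

Variables (F : fieldType) (L : leibnizType F).
Implicit Types (x y z u v h c t : L) (k l m : F).
Implicit Types (P Q U : L -> Prop) (A I J : {vspace L}).

Hypothesis infF : forall s : seq F, exists a : F, a \notin s.
Hypothesis char2 : (2%:R : F) != 0.
Hypothesis locally_flagged :
  forall x y, exists A, [/\ x \in A, y \in A & flagged A].

Lemma common_eigenvector I U (X : seq L) :
  (forall z, stable z (fun v => v \in I)) -> lin U -> (forall z, stable z U) ->
  (exists u, U u /\ u \notin I) ->
  exists v, [/\ U v, v \notin I, forall y z, lbz (lbz y z) v \in I
    & forall t, t \in X -> exists k, lbz t v - k *: v \in I].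
Proof.
move=> sI lU sU [u [Uu uI]]; have lI := lin_vspace I.
elim: X => [|x X [v [Uv vI Dv Xv]]].
  have [x [E [xx sE mE]]] := exists_maximal locally_flagged.
  have [|v [Uv /negP vI Dv]] :=
    derived_triangular infF char2 locally_flagged xx sE mE lI sU sI.
    by exists u; split=> //; apply/negP.
  by exists v; split.
(* [W] is stable under [x] and contains [v]; since [L_x] splits on [v], some
   product of operators [L_x - l] applied to [v] is an eigenvector modulo [I]. *)
pose W w := [/\ U w, forall y z, lbz (lbz y z) w \in I
  & forall t, t \in X -> forall k,
      lbz t v - k *: v \in I -> lbz t w - k *: w \in I].
have W_lsub w m : W w -> W (lsub x m w).
  case=> Uw Dw Xw; split.
  - exact: (stable_lsub m lU (sU x) Uw).
  - move=> y z; rewrite lbzBr lbzZr memvB ?memvZ //.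
    by rewrite lbz_leibniz memvD //; apply: sI.
  - move=> t tX k /(Xw t tX) kw.
    have -> : lbz t (lsub x m w) - k *: lsub x m w =
              lbz (lbz t x) w + lsub x m (lbz t w - k *: w).
      rewrite /lsub !lbzBr !lbzZr lbz_leibniz !scalerBr !opprB !scalerA.
      rewrite [m * k]mulrC -!addrA; congr (_ + (_ + _)).
      by rewrite addrCA [RHS]addrCA [X in _ + X]addrC.
    by rewrite memvD //; apply: (stable_lsub m lI (sI x)).
have [A [xA vA fA]] := locally_flagged x v.
have [s sv] := flagged_split fA xA vA.
have {sv}: foldr (lsub x) v s \in I by rewrite sv mem0v.
have Ws r : W (foldr (lsub x) v r) by elim: r => //= l r; apply: W_lsub.
elim: s => [|l s IH] /=; first by rewrite (negPf vI).
have [/IH//|nI] := boolP (foldr (lsub x) v s \in I) => lI'.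
exists (foldr (lsub x) v s); have [Uw Dw Xw] := Ws s; split=> // t.
rewrite inE => /predU1P[->|tX]; first by exists l.
by have [k kv] := Xv t tX; exists k; apply: Xw.
Qed.

(** Every proper ideal is contained in an ideal of one dimension more. *)
Lemma ideal_step I : is_ideal I -> I != fullv ->
  exists J, [/\ is_ideal J, (I <= J)%VS & \dim J = (\dim I).+1].
Proof.
move=> iI In; have sI z : stable z (fun v => v \in I).
  by move=> v vI; have [] := iI z v vI.
pose K v := forall z, lbz v z \in I.
have sK z : stable z K.
  by move=> v Kv y; rewrite lbzA memvB // sI.
have lK : lin K.
  split=> [z|a u v Ku Kv z]; first by rewrite lbz0l mem0v.
  by rewrite lbzDl lbzZl memvD ?memvZ.
have full J v : (forall t, t \in vbasis {:L} -> exists k, lbz t v - k *: v \in J) ->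
    forall t, exists k, lbz t v - k *: v \in J.
  move=> H t; apply: (lin_span (X := vbasis {:L}) _ H); last first.
    by rewrite (span_basis (vbasisP _)) memvf.
  split=> [|a p q [k kp] [m mq]].
    by exists 0; rewrite lbz0l scale0r subrr mem0v.
  exists (a * k + m); rewrite lbzDl lbzZl scalerDl opprD addrACA -scalerA -scalerBr.
  by rewrite memvD ?memvZ.
have add v : v \notin I -> (forall t, exists k, lbz t v - k *: v \in I) ->
    (forall t, lbz v t \in (I + <[v]>)%VS) ->
    exists J, [/\ is_ideal J, (I <= J)%VS & \dim J = (\dim I).+1].
  move=> vI lv rv; exists (I + <[v]>)%VS; split; last 2 first.
  - exact: addvSl.
  - exact: dim_add_line.
  move=> x a /memv_addP[b bI [_ /vlineP[k ->] ->]]; have [xb bx] := iI x b bI.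
  rewrite lbzDr lbzDl lbzZr lbzZl; split; rewrite memvD ?memvZ //.
  - exact: (subvP (addvSl _ _)).
  - have [m mv] := lv x; rewrite -[lbz x v](subrK (m *: v)).
    by rewrite memv_add // memvZ // memv_line.
  - exact: (subvP (addvSl _ _)).
have [[u [Ku uI]]|noK] := classic (exists u, K u /\ u \notin I).
  have exu : exists u, K u /\ u \notin I by exists u.
  have [v [Kv vI _ Xv]] := common_eigenvector (vbasis {:L}) sI lK sK exu.
  apply: (add v vI); first exact: full.
  by move=> t; apply: (subvP (addvSl _ _)); apply: Kv.
have KI v : K v -> v \in I.
  by move=> Kv; apply: contraPT noK => vI; case; exists v.
have [u uI] : exists u, u \notin I.
  apply: NNPP => no; case/eqP: In; apply/vspaceP => v; rewrite memvf.
  by apply: contraPT no => vI; case; exists v.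
have [v [_ vI _ Xv]] : exists v, [/\ True, v \notin I,
      forall y z, lbz (lbz y z) v \in I
    & forall t, t \in vbasis {:L} -> exists k, lbz t v - k *: v \in I].
  by apply: (@common_eigenvector I (fun=> True)) => //; exists u.
apply: (add v vI); first exact: full.
move=> t; have [k kv] := full _ _ Xv t.
(* [L_tv + L_vt = 0] by the Leibniz identity. *)
have tv : lbz t v + lbz v t \in I.
  by apply: KI => z; rewrite lbzDl !lbzA addrC subrKA subrr mem0v.
have -> : lbz v t = (lbz t v + lbz v t - (lbz t v - k *: v)) + (- k) *: v.
  by rewrite scaleNr -[RHS]addrA -opprD subrK [RHS]addrAC subrr add0r.
apply: memv_add; first by rewrite memvB.
by apply/vlineP; exists (- k).
Qed.

Theorem supersolvable_of_locally_flagged : supersolvable L.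
Proof.
suff H (d : nat) : (d <= \dim {:L})%N -> exists I : nat -> {vspace L},
    [/\ I 0%N = 0%VS, forall s, (s < d)%N -> (I s <= I s.+1)%VS
      & forall s, (s <= d)%N -> is_ideal (I s) /\ \dim (I s) = s].
  have [I [I0 Is Id]] := H _ (leqnn _); exists (\dim {:L}), I; split=> //.
  by apply/eqP; rewrite eqEdim subvf (Id _ (leqnn _)).2 leqnn.
elim: d => [_|d IH dL].
  exists (fun=> 0%VS); split=> // s; rewrite leqn0 => /eqP ->.
  split; last exact: dimv0.
  by move=> x a; rewrite memv0 => /eqP ->; rewrite lbz0l lbz0r mem0v.
have [I [I0 Is Id]] := IH (ltnW dL); have [iId dId] := Id d (leqnn _).
have [|J [iJ IJ dJ]] := ideal_step iId.
  by apply: contraTneq dL => e; rewrite -dId e ltnn.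
exists (fun s => if (s <= d)%N then I s else J); split=> //= s.
  rewrite ltnS => le; rewrite le; case: ltnP => [|ds]; first exact: Is.
  by have /eqP -> : s == d by rewrite eqn_leq le.
case: (leqP s d) => [sd _|ds sd]; first exact: Id.
by have /eqP -> : s == d.+1; [rewrite eqn_leq sd | rewrite dJ dId].
Qed.

End Supersolvable.

(** * Subalgebras and base fields *)

Section Recognition.
Set Implicit Arguments.
Unset Strict Implicit.
Import GRing.Theory.
Local Open Scope ring_scope.

Lemma flagged_subalgebra (F : fieldType) (L : leibnizType F) (A : subalgebra L) :
  supersolvable (subvs_of A) -> flagged A.
Proof.
case=> n [I [I0 In Is Id]]; split; first exact: Defs.subalg_closed.
pose f : 'Hom(subvs_of A, L) := linfun vsval.
have fE u : f u = vsval u by rewrite lfunE.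
have kf : lker f = 0%VS.
  by apply/eqP/lker0P => u v; rewrite !fE; apply: val_inj.
have dimf (V : {vspace subvs_of A}) : \dim (f @: V) = \dim V.
  by apply: limg_dim_eq; rewrite kf capv0.
exists n, (fun s => (f @: I s)%VS); split.
- by rewrite I0 limg0.
- rewrite In; apply/vspaceP => v; apply/memv_imgP/idP => [[u _ ->]|vA].
    by rewrite fE subvsP.
  by exists (Subvs vA); rewrite ?memvf // fE.
- move=> s sn; split; first exact: limgS (Is s sn).
  by rewrite !dimf (Id _ sn).2 (Id _ (ltnW sn)).2.
move=> s /Id[iI _] u v uA /memv_imgP[w wI ->].
have [xw _] := iI (Subvs uA) w wI.
by apply/memv_imgP; exists (lbz (Subvs uA : subvs_of A) w); rewrite ?fE.
Qed.

Lemma infinite_field (F : fieldType) :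
  [pchar F] =i pred0 \/ GRing.closed_field_axiom F ->
  forall s : seq F, exists t, t \notin s.
Proof.
case=> [ch0|closed] s.
  have inj : injective (fun n : nat => n%:R : F).
    have H (m n : nat) : (m <= n)%N -> m%:R = n%:R :> F -> m = n.
      move=> le e; apply/eqP; rewrite eqn_leq le /= -subn_eq0.
      by rewrite -(pcharf0P F).1 // natrB // e subrr.
    move=> m n e; case/orP: (leq_total m n) => le; first exact: H.
    by apply/esym/H.
  apply: NNPP => no.
  pose r : seq F := [seq n%:R | n <- iota 0 (size s).+1].
  have ur : uniq r by rewrite map_inj_uniq ?iota_uniq.
  have rs : {subset r <= s}.
    by move=> t _; apply: contraPT no => ts; case; exists t.
  by have := uniq_leq_size ur rs; rewrite size_map size_iota ltnn.
(* A root of [q + 1] is not in [s], where [q] vanishes. *)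
pose q : {poly F} := 'X * \prod_(a <- s) ('X - a%:P).
have [t tP] := closed (size s).+1 (fun i => - (q + 1)`_i) (ltn0Sn _).
exists t; apply/negP => ts.
have mon : q \is monic by rewrite monicMl ?monicX // monic_prod_XsubC.
have sq : size q = (size s).+2.
  by rewrite size_monicM ?monicX ?monic_neq0 ?monic_prod_XsubC //
    size_polyX size_prod_XsubC.
have lq : (q + 1)`_(size s).+1 = 1.
  by rewrite coefD coef1 addr0 -(monicP mon) lead_coefE sq.
have : (q + 1).[t] = 0.
  rewrite horner_coef size_polyDl ?size_poly1 ?sq // big_ord_recr /= lq mul1r tP.
  by rewrite -big_split /= big1 // => i _; rewrite mulNr addrN.
have q0 : q.[t] = 0.
  apply/eqP; rewrite hornerM mulf_eq0 -[_.[t] == 0]/(root _ t).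
  by rewrite -[_.[t] == 0]/(root _ t) root_prod_XsubC ts orbT.
by rewrite hornerD q0 add0r hornerE => /eqP; rewrite oner_eq0.
Qed.

End Recognition.

Theorem theorem5 (F : fieldType)
    (hF : [pchar F]%R =i pred0 \/
          (GRing.closed_field_axiom F /\
           exists2 p : nat, p \in [pchar F]%R & 5 < p)) :
  recognizeable 2 (@supersolvable F).
Proof.
move=> L H; apply: supersolvable_of_locally_flagged.
- by apply: infinite_field; case: hF => [|[]]; [left | right].
- case: hF => [ch0|[_ [p pF p5]]].
    by apply/negP => e; have := ch0 2; rewrite !inE e.
  apply/negP; rewrite -(GRing.dvdn_pcharf pF) => /dvdn_leq.
  by move/(_ isT); rewrite leqNgt (leq_trans (_ : 3 <= 6) p5).
move=> x y; have [A genA] := generates_exists [tuple x; y].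
exists A; have [sub _] := genA; split; try by apply: sub; rewrite !inE eqxx ?orbT.
exact: flagged_subalgebra (H _ _ genA).
Qed.
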